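(* The ring $R$ is not Noetherian.
   Context: An integer-valued quasi-polynomial is a function $f:\mathbb{Z}\to\mathbb{Z}$ for which there exist a positive integer $T$ and polynomials $f_0,\dots,f_{T-1}\in\mathbb{Z}[x]$ such that $f(Tm+i)=f_i(m)$ for all $m\in\mathbb{Z}$ and $0\le i\le T-1$. $R$ denotes the commutative ring of all integer-valued quasi-polynomials with pointwise addition and multiplication. *)

(* Defs.v *)
From HB Require Import structures.
From mathcomp Require Import all_boot all_order all_algebra.
From mathcomp Require Import all_classical.

Set Implicit Arguments.
Unset Strict Implicit.
Unset Printing Implicit Defensive.

Import GRing.Theory.

Local Open Scope ring_scope.

(* The family [F] gives the constituents of [f] with respect to the modulus
   [T]; [T] need not be the minimal period. *)
Definition has_constituents (f : int -> int) (T : nat)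
    (F : 'I_T -> {poly int}) : Prop :=
  forall (m : int) (i : 'I_T), f (T%:Z * m + (i : nat)%:Z) = (F i).[m].

Definition quasi_polynomial (f : int -> int) : Prop :=
  exists T : nat, (0 < T)%N /\
    exists F : 'I_T -> {poly int}, has_constituents f F.

Definition is_quasipoly : {pred (int -> int)} :=
  fun f => `[< quasi_polynomial f >].

Lemma has_constituents_mul (f : int -> int) (T k : nat)
    (F : 'I_T -> {poly int}) :
  has_constituents f F ->
  exists G : 'I_(T * k) -> {poly int}, has_constituents f G.
Proof.
case: T F => [|T] F fF.
  by exists (fun=> 0) => m i; case: i => i; rewrite mul0n.
exists (fun i => F (inord (i %% T.+1)) \Po (k%:Z *: 'X + (i %/ T.+1)%:Z%:P)).
move=> m i; rewrite horner_comp !hornerE -fF inordK ?ltn_pmod//.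
congr f; rewrite {1}(divn_eq i T.+1) !PoszD !PoszM mulrDr !mulrA addrA.
by congr (_ + _ + _); rewrite mulrC.
Qed.

Lemma common_modulus (f g : int -> int) :
  quasi_polynomial f -> quasi_polynomial g ->
  exists T : nat, (0 < T)%N /\ exists F G : 'I_T -> {poly int},
    has_constituents f F /\ has_constituents g G.
Proof.
move=> [T [T0 [F fF]]] [U [U0 [G gG]]].
have [F' fF'] := has_constituents_mul U fF.
have [G' gG'] := has_constituents_mul T gG.
exists (T * U)%N; split; first by rewrite muln_gt0 T0.
by exists F'; rewrite mulnC in G' gG' *; exists G'.
Qed.

Lemma is_quasipoly_subring : subring_closed is_quasipoly.
Proof.
split; [|move=> f g|move=> f g].
- apply/asboolP; exists 1%N; split => //; exists (fun=> 1) => m i.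
  by rewrite hornerC.
- move=> /asboolP qf /asboolP qg; apply/asboolP.
  have [T [T0 [F [G [fF gG]]]]] := common_modulus qf qg.
  exists T; split => //; exists (fun i => F i - G i) => m i.
  by rewrite hornerD hornerN -fF -gG.
- move=> /asboolP qf /asboolP qg; apply/asboolP.
  have [T [T0 [F [G [fF gG]]]]] := common_modulus qf qg.
  exists T; split => //; exists (fun i => F i * G i) => m i.
  by rewrite hornerM -fF -gG.
Qed.

HB.instance Definition _ :=
  GRing.isSubringClosed.Build (int -> int) is_quasipoly is_quasipoly_subring.

Record quasipoly := Quasipoly {
  quasipoly_fun :> int -> int;
  _ : quasipoly_fun \in is_quasipoly }.

HB.instance Definition _ := [isSub for quasipoly_fun].
HB.instance Definition _ := [Choice of quasipoly by <:].
HB.instance Definition _ :=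
  GRing.SubChoice_isSubComPzRing.Build (int -> int) is_quasipoly quasipoly
    is_quasipoly_subring.

Definition is_ideal (R : comPzRingType) (I : set R) : Prop :=
  [/\ I 0, forall x y, I x -> I y -> I (x + y) & forall a x, I x -> I (a * x)].

Definition generated_ideal (R : comPzRingType) (n : nat) (g : 'I_n -> R) :
    set R :=
  [set x | exists a : 'I_n -> R, x = \sum_(i < n) a i * g i]%classic.

Definition finitely_generated (R : comPzRingType) (I : set R) : Prop :=
  exists (n : nat) (g : 'I_n -> R), I = generated_ideal g.

Definition noetherian (R : comPzRingType) : Prop :=
  forall I : set R, is_ideal I -> finitely_generated I.

(* Main.v *)
Require Import Defs.
From mathcomp Require Import all_boot all_order all_algebra.
From mathcomp Require Import all_classical.

(** Noetherianity fails because the quasi-polynomials vanishing on [2 ^ n Z]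
    form a strictly ascending chain of ideals indexed by [n]. The chain is
    ascending because the sets [2 ^ n Z] shrink. It is strict because
    indicator functions of residue classes are quasi-polynomials: the function
    equal to 0 on [2 ^ n.+1 Z] and to 1 elsewhere vanishes on [2 ^ n.+1 Z]
    ([noncongruence0_vanishing]), but takes the value 1 at [2 ^ n]. In a
    Noetherian ring every ascending chain of ideals is stationary
    ([noetherian_ascending_chain]). *)

Set Implicit Arguments.
Unset Strict Implicit.
Unset Printing Implicit Defensive.

Import GRing.Theory.

Local Open Scope classical_set_scope.
Local Open Scope ring_scope.

Lemma is_ideal_sum (R : comPzRingType) (I : set R) (n : nat)
    (a g : 'I_n -> R) :
  is_ideal I -> (forall i, I (g i)) -> I (\sum_(i < n) a i * g i).
Proof.
move=> [I0 ID IM] gI; apply: big_ind => [//|x y|i _]; first exact: ID.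
exact: IM.
Qed.

Lemma generator_in_generated_ideal (R : comPzRingType) (n : nat)
    (g : 'I_n -> R) (i : 'I_n) : generated_ideal g (g i).
Proof.
exists (fun j => (j == i)%:R).
rewrite (bigD1 i)//= eqxx mul1r big1 ?addr0// => j /negPf ->.
by rewrite mul0r.
Qed.

(** The union of the chain is an ideal; each of its finitely many generators
    lies in some term, and the largest of the indices involved works. *)
Lemma noetherian_ascending_chain (R : comPzRingType) (J : nat -> set R) :
  noetherian R -> (forall n, is_ideal (J n)) ->
  (forall m n, (m <= n)%N -> J m `<=` J n) ->
  exists N, forall n, J n `<=` J N.
Proof.
move=> noethR Jideal Jmono.
have [|k [g Ug]] := noethR (\bigcup_n J n).
  split=> [|x y [m _ Jx] [n _ Jy]|a x [n _ Jx]].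
  - by exists 0%N => //; have [] := Jideal 0%N.
  - exists (maxn m n) => //; have [_ JD _] := Jideal (maxn m n).
    by apply: JD; [apply: Jmono Jx|apply: Jmono Jy];
      rewrite ?leq_maxl ?leq_maxr.
  - by exists n => //; have [_ _ JM] := Jideal n; apply: JM.
have /choice[h Jg] : forall i, exists n, J n (g i).
  move=> i; have : (\bigcup_n J n) (g i).
    by rewrite Ug; exact: generator_in_generated_ideal.
  by case=> n _ Jgi; exists n.
exists (\max_i h i)%N => n x Jx.
have : (\bigcup_n J n) x by exists n.
rewrite Ug => -[a ->]; apply: is_ideal_sum => // i.
by apply: Jmono (Jg i); exact: leq_bigmax.
Qed.

Definition vanishing_on_multiples (d : nat) : set quasipoly :=
  [set f | forall m : int, f (d%:Z * m) = 0].

Lemma vanishing_on_multiples_ideal (d : nat) :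
  is_ideal (vanishing_on_multiples d).
Proof.
split=> [//|f g f0 g0 m|a f f0 m].
- by rewrite -[LHS]/(f (d%:Z * m) + g (d%:Z * m)) f0 g0 addr0.
- by rewrite -[LHS]/(a (d%:Z * m) * f (d%:Z * m)) f0 mulr0.
Qed.

Lemma vanishing_on_multiples_dvdn (d e : nat) :
  (d %| e)%N -> vanishing_on_multiples d `<=` vanishing_on_multiples e.
Proof. by move=> /dvdnP[k ->] f f0 m; rewrite mulnC PoszM -mulrA. Qed.

Definition noncongruence0 (d : nat) (x : int) : int := (~~ (d %| x)%Z)%:R.

(** With modulus [d], all constituents are constants. *)
Lemma noncongruence0_quasipoly (d : nat) :
  (0 < d)%N -> noncongruence0 d \in is_quasipoly.
Proof.
move=> d0; apply/asboolP; exists d; split => //.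
exists (fun i => ((~~ (d %| i)%N)%:R : int)%:P) => m i.
by rewrite hornerC /noncongruence0 rpredDl ?dvdz_mulr.
Qed.

Lemma noncongruence0_vanishing (d : nat) (d0 : (0 < d)%N) :
  vanishing_on_multiples d (Quasipoly (noncongruence0_quasipoly d0)).
Proof. by move=> m; rewrite /= /noncongruence0 dvdz_mulr. Qed.

Theorem proposition8 : ~ noetherian quasipoly.
Proof.
move=> noethR.
have [||N JN] := noetherian_ascending_chain
    (J := fun n => vanishing_on_multiples (2 ^ n)) noethR.
- by move=> n; exact: vanishing_on_multiples_ideal.
- by move=> m n mn; apply: vanishing_on_multiples_dvdn; exact: dvdn_exp2l.
have d0 : (0 < 2 ^ N.+1)%N by rewrite expn_gt0.
have /(_ 1) := JN _ _ (noncongruence0_vanishing d0).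
by rewrite /= mulr1 /noncongruence0 dvdzE /= dvdn_Pexp2l// ltnn.
Qed.
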